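(* Let $n\ge 1$, let $W\subset\mathbf{R}^{n+1}$ be a linear subspace, put $\tilde M=W\cap\mathbf{R}^{n+1}_+$, and assume that $a\in\tilde M$. Let $V\subset\mathbf{R}^{n+1}$ be a linear subspace. Then $$\log\tilde M=\log\left\{(a+W)\cap\mathbf{R}^{n+1}_+\right\}=\log a+V$$ if and only if the following two conditions both hold: 1) $V=a^{-1}\circ W$; 2) for all $u,w\in W$, $u\circ a^{-1}\circ w\in W$.
   Context: $\mathbf{R}^{n+1}_+=\{p=(p_i)\in\mathbf{R}^{n+1}\mid p_i>0,\ i=1,\dots,n+1\}$ is the open positive orthant. For $p\in\mathbf{R}^{n+1}_+$, $\log p:=(\log p_i)\in\mathbf{R}^{n+1}$ (componentwise), and for a subset $\mathcal{Q}\subset\mathbf{R}^{n+1}_+$, $\log\mathcal{Q}:=\{\log p\mid p\in\mathcal{Q}\}$. The Hadamard product on $\mathbf{R}^{n+1}$ is $x\circ y=(x_iy_i)$; for $x$ with all components nonzero, $x^{-1}=(1/x_i)$. For a subspace $W$, $a^{-1}\circ W:=\{a^{-1}\circ w\mid w\in W\}$, and $\log a+V:=\{\log a+v\mid v\in V\}$. *)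

(* Defs.v *)
From HB Require Import structures.
From mathcomp Require Import all_boot all_order all_algebra.
From mathcomp Require Import all_classical all_reals.
From mathcomp Require Import exp.

Set Implicit Arguments.
Unset Strict Implicit.
Unset Printing Implicit Defensive.

Import Order.TTheory GRing.Theory Num.Theory.

Local Open Scope classical_set_scope.
Local Open Scope ring_scope.

Definition orthant {R : realType} {m : nat} : set 'rV[R]_m :=
  [set p | forall i, 0 < p 0 i].

Definition hadamard {R : realType} {m : nat} (x y : 'rV[R]_m) : 'rV[R]_m :=
  map2_mx *%R x y.

(* Meaningful when all components of x are nonzero. *)
Definition hinv {R : realType} {m : nat} (x : 'rV[R]_m) : 'rV[R]_m :=
  map_mx GRing.inv x.

(* Meaningful on the orthant: ln is 0 on nonpositive reals. *)
Definition logv {R : realType} {m : nat} (p : 'rV[R]_m) : 'rV[R]_m :=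
  map_mx (@ln R) p.

Definition translate {R : realType} {m : nat} (b : 'rV[R]_m)
    (U : {vspace 'rV[R]_m}) : set 'rV[R]_m :=
  [set b + u | u in [set` U]].

(* Main.v *)
Require Import Defs.
From HB Require Import structures.
From mathcomp Require Import all_boot all_order all_algebra.
From mathcomp Require Import all_classical all_reals.
From mathcomp Require Import sequences exp.
From mathcomp Require Import ring.

Set Implicit Arguments.
Unset Strict Implicit.
Unset Printing Implicit Defensive.

Import Order.TTheory GRing.Theory Num.Theory.

Local Open Scope classical_set_scope.
Local Open Scope ring_scope.

(** Dividing by [a] entrywise turns [W] into a subspace [U = a^-1 o W] that
    contains the all-ones vector, and turns the two equations into
    [log (U+) = V], where [U+] is the set of positive vectors of [U]; indeed
    [a + W = W], and [log] changes the division into a translation.  The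
    condition on [u o a^-1 o w] says that [U] is closed under entrywise
    products, that is, a unital subalgebra of [R^m].  It remains to see that
    [log (U+) = V] holds if and only if [V = U] and [U] is a subalgebra.

    Both directions go through a third property of [U]: closure under the
    entrywise application of every function [f : R -> R].  A vector [x] has
    finitely many entries, so [f], however irregular, agrees on them with a
    polynomial.  Hence a linear subspace that contains all powers of [x] also
    contains [f x] (lemma [entrywise_of_powers]).

    A unital subalgebra contains the powers of its elements, so it has this
    closure property; applying it to [ln] and to [expR] gives [log (U+) = U].

    Conversely, let [log (U+)] be a linear subspace [V].  If [v] is in [V] then
    so is every multiple [k v], so every power [exp (k v)] of [exp v] is in [U],
    and [U] contains all entrywise functions of [exp v], hence of [v].  Any [u]
    in [U] becomes positive after adding a constant [c], and is a function of
    [log (u + c)], which is in [V].  So [U] is closed under entrywise functions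
    (lemma [subspace_log_entrywise]), in particular under squares, and by
    polarization under products.  Closure under entrywise functions also gives
    [log (U+) = U] as before, hence [V = U]. *)

(** * Entrywise functions and interpolation *)

Definition entrywise_closed (R : realType) (m : nat)
    (U : {vspace 'rV[R]_m}) : Prop :=
  forall (f : R -> R) (u : 'rV[R]_m), u \in U -> map_mx f u \in U.

Definition hadamard_closed (R : realType) (m : nat)
    (U : {vspace 'rV[R]_m}) : Prop :=
  forall u w : 'rV[R]_m, u \in U -> w \in U -> hadamard u w \in U.

(** Newton interpolation: the induction on [s] adds to the interpolant of the
    tail a multiple of the polynomial that vanishes on the tail, so repeated
    points need no special treatment. *)
Lemma interpolation (F : fieldType) (f : F -> F) (s : seq F) :
  exists p : {poly F}, {in s, forall y, p.[y] = f y}.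
Proof.
elim: s => [|y s [p hp]]; first by exists 0.
have [ys|ys] := boolP (y \in s).
  by exists p => z; rewrite inE => /orP[/eqP ->|]; exact: hp.
pose q := \prod_(z <- s) ('X - z%:P).
have qy : q.[y] != 0 by rewrite -rootE root_prod_XsubC.
exists (p + ((f y - p.[y]) / q.[y]) *: q) => z.
rewrite inE hornerD hornerZ => /orP[/eqP ->|zs].
  by rewrite divfK // addrC subrK.
have /rootP -> : root q z by rewrite root_prod_XsubC.
by rewrite mulr0 addr0 hp.
Qed.

(** A polynomial that agrees with [f] on the entries of [x] writes [f x] as a
    linear combination of the powers of [x]. *)
Lemma entrywise_of_powers (R : realType) (m : nat) (U : {vspace 'rV[R]_m})
    (x : 'rV[R]_m) (f : R -> R) :
  (forall k : nat, map_mx (fun t => t ^+ k) x \in U) -> map_mx f x \in U.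
Proof.
move=> xk; have [p hp] := interpolation f [seq x 0 i | i <- enum 'I_m].
have -> : map_mx f x = \sum_(k < size p) p`_k *: map_mx (fun t => t ^+ k) x.
  apply/rowP => i; rewrite mxE summxE -hp; last by rewrite map_f ?mem_enum.
  rewrite horner_coef.
  by apply: eq_bigr => k _; rewrite !mxE.
by apply: memv_suml => k _; apply: memvZ.
Qed.

Lemma hadamard_closed_entrywise (R : realType) (m : nat)
    (U : {vspace 'rV[R]_m}) :
  const_mx 1 \in U -> hadamard_closed U -> entrywise_closed U.
Proof.
move=> U1 UM f u uU; apply: entrywise_of_powers => k.
elim: k => [|k IHk].
  by rewrite (_ : map_mx _ _ = const_mx 1) //; apply/rowP => i; rewrite !mxE expr0.
rewrite (_ : map_mx _ _ = hadamard u (map_mx (fun t => t ^+ k) u)); first exact: UM.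
by apply/rowP => i; rewrite !mxE exprS.
Qed.

Lemma entrywise_hadamard_closed (R : realType) (m : nat)
    (U : {vspace 'rV[R]_m}) :
  entrywise_closed U -> hadamard_closed U.
Proof.
move=> Uf u w uU wU.
have sqU v : v \in U -> map_mx (fun t => t ^+ 2) v \in U by exact: Uf.
(* Polarization: u w = ((u + w)^2 - u^2 - w^2) / 2 *)
have -> : hadamard u w = 2^-1 *: (map_mx (fun t => t ^+ 2) (u + w)
    - map_mx (fun t => t ^+ 2) u - map_mx (fun t => t ^+ 2) w).
  by apply/rowP => i; rewrite !mxE; field.
by rewrite memvZ // !memvB // sqU // memvD.
Qed.

(** * Logarithms of the positive part of a subspace *)

(** Closure under [ln] gives one inclusion; closure under [expR], a right
    inverse of [ln], gives the other. *)
Lemma logv_image_closed (R : realType) (m : nat) (U : {vspace 'rV[R]_m}) :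
  entrywise_closed U -> logv @` ([set` U] `&` orthant) = [set` U].
Proof.
move=> Uf; apply/seteqP; split => [_ [p [pU _] <-]|u uU]; first exact: Uf.
exists (map_mx expR u); last by apply/rowP => i; rewrite !mxE expRK.
by split=> [|i]; [exact: Uf|rewrite mxE expR_gt0].
Qed.

(** The powers of [exp v] are the exponentials of the multiples of [v], so they
    lie in [U] because [V] is closed under scaling; interpolation then puts every
    function of [v] in [U].  Adding a large constant to [u] makes [u] a function
    of a vector of [V]. *)
Lemma subspace_log_entrywise (R : realType) (m : nat)
    (U V : {vspace 'rV[R]_m}) :
  const_mx 1 \in U -> logv @` ([set` U] `&` orthant) = [set` V] ->
  entrywise_closed U.
Proof.
move=> U1 logUV.
have expU v : v \in V -> map_mx expR v \in U.
  move=> vV; have : [set` V] v by [].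
  rewrite -logUV => -[p [pU p_gt0] <-].
  suff -> : map_mx expR (logv p) = p by [].
  by apply/rowP => i; rewrite !mxE lnK // posrE.
have VfU (f : R -> R) v : v \in V -> map_mx f v \in U.
  move=> vV.
  have -> : map_mx f v = map_mx (f \o @ln R) (map_mx expR v).
    by apply/rowP => i; rewrite !mxE /= expRK.
  apply: entrywise_of_powers => k.
  suff -> : map_mx (fun t => t ^+ k) (map_mx expR v) = map_mx expR (k%:R *: v).
    by apply: expU; apply: memvZ.
  by apply/rowP => i; rewrite !mxE expRM_natl.
move=> f u uU.
(* Any constant exceeding all the |u_i| makes u + c positive. *)
pose c : R := 1 + \sum_i `|u 0 i|.
have uc_gt0 i : 0 < u 0 i + c.
  rewrite -ltrBlDl sub0r /c (bigD1 i) //=.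
  apply: (@le_lt_trans _ _ `|u 0 i|); first by rewrite -normrN ler_norm.
  by rewrite addrCA ltrDl ltr_pwDl // sumr_ge0.
pose v := logv (u + const_mx c).
have vV : v \in V.
  suff : [set` V] v by [].
  rewrite -logUV; exists (u + const_mx c) => //; split=> [|i]; last by rewrite !mxE.
  apply: memvD => //.
  rewrite (_ : const_mx c = c *: const_mx 1); first exact: memvZ.
  by apply/rowP => i; rewrite !mxE mulr1.
rewrite (_ : map_mx f u = map_mx (fun t => f (expR t - c)) v); first exact: VfU.
by apply/rowP => i; rewrite !mxE lnK ?posrE // addrK.
Qed.

(** The case of the theorem in which the base point is the all-ones vector. *)
Lemma logv_subspaceP (R : realType) (m : nat) (U V : {vspace 'rV[R]_m}) :
  const_mx 1 \in U ->
  logv @` ([set` U] `&` orthant) = [set` V] <->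
  [set` V] = [set` U] /\ hadamard_closed U.
Proof.
move=> U1; split=> [logUV|[-> UM]]; last first.
  exact/logv_image_closed/hadamard_closed_entrywise.
have Uf := subspace_log_entrywise U1 logUV.
by split; [rewrite -logUV logv_image_closed|exact: entrywise_hadamard_closed].
Qed.

(** * Reduction to the all-ones base point *)

Section Rescaling.
Variables (R : realType) (m : nat) (a : 'rV[R]_m) (W : {vspace 'rV[R]_m}).

(** The subspace [a^-1 o W], as a preimage so that its membership test
    involves no division. *)
Definition rescale : {vspace 'rV[R]_m} :=
  (linfun (mulmxr (diag_mx a)) @^-1: W)%VS.

Lemma mem_rescale x : (x \in rescale) = (hadamard a x \in W).
Proof.
rewrite /rescale -memv_preim lfunE /= mul_mx_diag; congr (_ \in W).
by apply/rowP => i; rewrite !mxE mulrC.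
Qed.

Hypotheses (aW : a \in W) (a_gt0 : forall i, 0 < a 0 i).

Let a_neq0 i : a 0 i != 0. Proof. exact: lt0r_neq0. Qed.

Lemma hadamardVK x : hadamard a (hadamard (hinv a) x) = x.
Proof. by apply/rowP => i; rewrite !mxE mulVKf. Qed.

Lemma hadamardKV x : hadamard (hinv a) (hadamard a x) = x.
Proof. by apply/rowP => i; rewrite !mxE mulKf. Qed.

Lemma const1_rescale : const_mx 1 \in rescale.
Proof.
rewrite mem_rescale (_ : hadamard a _ = a) //.
by apply/rowP => i; rewrite !mxE mulr1.
Qed.

Lemma rescaleE : [set` rescale] = [set hadamard (hinv a) w | w in [set` W]].
Proof.
apply/seteqP; split => [x /=|_ [w wW <-] /=].
  by rewrite mem_rescale => aW'; exists (hadamard a x) => //; exact: hadamardKV.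
by rewrite mem_rescale hadamardVK.
Qed.

Lemma hadamard_closed_rescale :
  hadamard_closed rescale <->
  (forall u w, u \in W -> w \in W -> hadamard (hadamard u (hinv a)) w \in W).
Proof.
split=> [UM u w uW wW|WM x y].
  have := UM (hadamard (hinv a) u) (hadamard (hinv a) w).
  rewrite !mem_rescale !hadamardVK => /(_ uW wW).
  rewrite (_ : hadamard a _ = hadamard (hadamard u (hinv a)) w) //.
  by apply/rowP => i; rewrite !mxE; field.
rewrite !mem_rescale => xW yW; have := WM _ _ xW yW.
rewrite (_ : hadamard (hadamard (hadamard a x) _) _ = hadamard a (hadamard x y)) //.
by apply/rowP => i; rewrite !mxE; field.
Qed.

Lemma translate_mem : translate a W = [set` W].
Proof.
apply/seteqP; split => [_ [w wW <-] /=|w wW]; first exact: memvD.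
by exists (w - a); [exact: memvB|rewrite addrC subrK].
Qed.

(** The map [x |-> a o x] is a bijection from the positive vectors of [rescale]
    to those of [W], and [log] turns it into the translation by [log a]. *)
Lemma logv_rescale :
  logv @` ([set` W] `&` orthant) =
  [set logv a + v | v in logv @` ([set` rescale] `&` orthant)].
Proof.
have logM x : orthant x -> logv (hadamard a x) = logv a + logv x.
  by move=> x_gt0; apply/rowP => i; rewrite !mxE lnM // posrE.
apply/seteqP; split => [_ [p [pW p_gt0] <-]|_ [_ [x [xU x_gt0] <-] <-]].
  have x_gt0 : orthant (hadamard (hinv a) p).
    by move=> i; rewrite !mxE mulr_gt0 ?invr_gt0.
  exists (logv (hadamard (hinv a) p)); last by rewrite -logM // hadamardVK.
  by exists (hadamard (hinv a) p) => //; split; rewrite //= mem_rescale hadamardVK.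
exists (hadamard a x); last exact: logM.
by split=> [|i]; [rewrite /= -mem_rescale|rewrite mxE mulr_gt0].
Qed.

End Rescaling.

Theorem theorem1 (R : realType) (n : nat) (hn : (1 <= n)%N)
    (W V : {vspace 'rV[R]_n.+1}) (a : 'rV[R]_n.+1)
    (ha : ([set` W] `&` orthant) a) :
  (logv @` ([set` W] `&` orthant) = logv @` (translate a W `&` orthant) /\
   logv @` (translate a W `&` orthant) = translate (logv a) V)
  <->
  ([set` V] = [set hadamard (hinv a) w | w in [set` W]] /\
   (forall u w : 'rV[R]_n.+1, u \in W -> w \in W ->
      hadamard (hadamard u (hinv a)) w \in W)).
Proof.
case: ha => aW a_gt0.
have untranslate : logv @` ([set` W] `&` orthant) = translate (logv a) V <->
    logv @` ([set` rescale a W] `&` orthant) = [set` V].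
  rewrite (logv_rescale W a_gt0); split=> [|-> //].
  move=> /seteqP[sub1 sub2]; apply/seteqP; split=> v.
    by move=> /(imageP (+%R (logv a)))/sub1[w wV /addrI <-].
  by move=> /(imageP (+%R (logv a)))/sub2[w wL /addrI <-].
rewrite translate_mem // -rescaleE // -hadamard_closed_rescale //.
have logUP := logv_subspaceP V (const1_rescale aW).
split=> [[_ /untranslate /logUP]//|/logUP /untranslate //].
Qed.
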